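(* There is an absolute constant $C>0$ such that for every nonempty finite set $A$ of real numbers, \[|A-A|\le C\,|\Delta(A\times A)|\,|A|^{-1/8}.\]
   Context: For a set $A\subset\mathbb{R}$, $A-A=\{a_1-a_2:a_1,a_2\in A\}$. For a finite set of points $P\subset\mathbb{R}^2$, the set of (squared) distances spanned by $P$ is \[\Delta(P)=\{(p_1-q_1)^2+(p_2-q_2)^2:(p_1,p_2),(q_1,q_2)\in P\}\] (the two points are allowed to coincide, so $0\in\Delta(P)$ when $P$ is nonempty). $|\cdot|$ denotes cardinality. *)

(* Defs.v *)
From HB Require Import structures.
From mathcomp Require Import all_boot all_order all_algebra.
From mathcomp Require Import finmap.
From mathcomp Require Import reals exp.

Set Implicit Arguments.
Unset Strict Implicit.
Unset Printing Implicit Defensive.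

Import Order.TTheory GRing.Theory Num.Theory.

Local Open Scope fset_scope.
Local Open Scope ring_scope.

Definition difference_set (R : realType) (A : {fset R}) : {fset R} :=
  [fset a1 - a2 | a1 in A, a2 in A].

(* Squared distances; [p = q] is allowed, so [0] is in [distance_set P]
   whenever [P] is nonempty. *)
Definition distance_set (R : realType) (P : {fset R * R}) : {fset R} :=
  [fset (p.1 - q.1) ^+ 2 + (p.2 - q.2) ^+ 2 | p in P, q in P].

(* Main.v *)
Require Import Defs.
From HB Require Import structures.
From mathcomp Require Import all_boot all_order all_algebra.
From mathcomp Require Import finmap.
From mathcomp Require Import reals exp.
From mathcomp Require Import zify ring lra.

Import Order.TTheory GRing.Theory Num.Theory.

Local Open Scope fset_scope.
Local Open Scope ring_scope.

(** Let [D = A - A] and let [B] be the set of squares of elements of [D], so that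
    [distance_set (A `*` A) = B + B] and [|D| <= 2 |B|]. Since
    [2 (a - d) (c - b) = (a - b)^2 + (d - c)^2 - (a - c)^2 - (d - b)^2],
    the set [4B - 4B] contains [2 (m d + M (a - a0))] for all [d] in [D] and
    [a] in [A], where [m] and [M] are the least and the greatest positive
    elements of [D]. For positive [d] these numbers are pairwise distinct,
    because [m |d - d'| < m M <= M |a - a'|] whenever [a <> a'].
    Hence [|4B - 4B|] is at least a constant times [|B| |A|], whereas the
    Plünnecke-Ruzsa inequality bounds it by [(|B + B| / |B|)^8 |B|]. *)

(** * Minimizers over finite lists and comparison of cardinalities *)

Lemma seq_min_exists {T : eqType} {R : realDomainType} (F : T -> R)
    (s : seq T) (x0 : T) : x0 \in s ->
  exists2 x, x \in s & forall y, y \in s -> F x <= F y.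
Proof.
elim: s x0 => [//|a s IH] _ _; case: s IH => [|b s] IH.
  by exists a; [rewrite inE | move=> y; rewrite inE => /eqP->].
have [x xs xmin] := IH b (mem_head b s).
have [le_ax|lt_xa] := leP (F a) (F x).
  exists a; first exact: mem_head.
  move=> y; rewrite inE => /orP[/eqP->//|/xmin]; exact: le_trans.
exists x; first by rewrite inE xs orbT.
by move=> y; rewrite inE => /orP[/eqP->|/xmin//]; exact: ltW.
Qed.

Lemma leq_card_mul {K1 K2 K : choiceType} {f : K1 -> K2 -> K}
    {X : {fset K1}} {Y : {fset K2}} {Z : {fset K}} :
  (forall x y, x \in X -> y \in Y -> f x y \in Z) ->
  (forall x y x' y', x \in X -> y \in Y -> x' \in X -> y' \in Y ->
     f x y = f x' y' -> x = x' /\ y = y') ->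
  (#|`X| * #|`Y| <= #|`Z|)%N.
Proof.
move=> fZ finj; rewrite -(size_allpairs f); apply: uniq_leq_size.
  apply: allpairs_uniq; rewrite ?fset_uniq //.
  move=> _ _ /allpairsP[[x y] /= [xX yY ->]] /allpairsP[[x' y'] /= [xX' yY' ->]].
  by move=> /= /(finj _ _ _ _ xX yY xX' yY')[-> ->].
by move=> _ /allpairsP[[x y] /= [xX yY ->]]; exact: fZ.
Qed.

Lemma leq_card_image {K1 K : choiceType} (f : K1 -> K)
    (X : {fset K1}) (Z : {fset K}) :
  (forall z, z \in Z -> exists2 x, x \in X & z = f x) -> (#|`Z| <= #|`X|)%N.
Proof.
move=> ZX; apply: (@leq_trans #|`f @` X|); last exact: leq_imfset_card.
by apply/fsubset_leq_card/fsubsetP=> z /ZX[x xX ->]; exact: in_imfset.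
Qed.

(** * Sumsets and the Plünnecke-Ruzsa inequality *)

Definition sumset {V : zmodType} (X Y : {fset V}) : {fset V} :=
  [fset x + y | x in X, y in Y].

Definition diffset {V : zmodType} (X Y : {fset V}) : {fset V} :=
  [fset x - y | x in X, y in Y].

Definition translate {V : zmodType} (c : V) (X : {fset V}) : {fset V} :=
  [fset x + c | x in X].

Definition msumset {V : zmodType} (n : nat) (X : {fset V}) : {fset V} :=
  iter n (sumset X) [fset 0].

Section Sumsets.
Variable V : zmodType.
Implicit Types (B C X Y Z : {fset V}).

Lemma sumsetP X Y z :
  reflect (exists x y, [/\ x \in X, y \in Y & z = x + y]) (z \in sumset X Y).
Proof.
apply: (iffP (imfset2P _ _ _ _ _)).
  by move=> [x xX [y yY ->]]; exists x, y.
by move=> [x [y [xX yY ->]]]; exists x => //; exists y.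
Qed.

Lemma diffsetP X Y z :
  reflect (exists x y, [/\ x \in X, y \in Y & z = x - y]) (z \in diffset X Y).
Proof.
apply: (iffP (imfset2P _ _ _ _ _)).
  by move=> [x xX [y yY ->]]; exists x, y.
by move=> [x [y [xX yY ->]]]; exists x => //; exists y.
Qed.

Lemma mem_sumset {X Y x y} : x \in X -> y \in Y -> x + y \in sumset X Y.
Proof. by move=> xX yY; apply/sumsetP; exists x, y. Qed.

Lemma sumset0 X : sumset X fset0 = fset0.
Proof. by apply/fsetP=> z; rewrite inE; apply/sumsetP=> -[x [y []]]. Qed.

Lemma sumset1 X : sumset X [fset 0] = X.
Proof.
apply/fsetP=> z; apply/sumsetP/idP=> [[x [y [xX]]]|zX].
  by rewrite inE => /eqP-> ->; rewrite addr0.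
by exists z, 0; rewrite inE addr0.
Qed.

Lemma mem_translate c X z : (z \in translate c X) = (z - c \in X).
Proof.
apply/imfsetP/idP=> [[x /= xX ->]|zX]; first by rewrite addrK.
by exists (z - c); rewrite // subrK.
Qed.

Lemma card_translate c X : #|`translate c X| = #|`X|.
Proof. by rewrite /translate card_imfset // => x y /addIr. Qed.

Lemma leq_card_sumset X Y y : y \in Y -> (#|`X| <= #|`sumset X Y|)%N.
Proof.
move=> yY; apply: (leq_card_image (fun z => z - y)) => x xX.
by exists (x + y); rewrite ?mem_sumset // addrK.
Qed.

Lemma mem_msumset1 {X x} : x \in X -> x \in msumset 1 X.
Proof. by rewrite /msumset /= sumset1. Qed.

Lemma mem_msumsetD {X m n x y} :
  x \in msumset m X -> y \in msumset n X -> x + y \in msumset (m + n) X.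
Proof.
elim: m x => [|m IH] x /=; first by rewrite inE => /eqP->; rewrite add0r.
move=> /sumsetP[b [c [bX cX ->]]] yn.
by rewrite -addrA; exact: mem_sumset bX (IH _ cX yn).
Qed.

(* Petridis' induction on [C]: adding [c] to [C] enlarges [X + C] by exactly
   the translates of the [x] outside [W], and enlarges [X + B + C] by at most
   [|X + B| - |W + B|]. *)
Lemma petridis X B C :
  (forall Z, Z `<=` X ->
     (#|`sumset X B| * #|`Z| <= #|`sumset Z B| * #|`X|)%N) ->
  (#|`sumset X (sumset B C)| * #|`X| <= #|`sumset X B| * #|`sumset X C|)%N.
Proof.
move=> Xmin; elim: {C}_.+1 {-2}C (ltnSn #|`C|) => // n IH C.
have [->|[c cC]] := fset_0Vmem C; first by rewrite !sumset0 cardfs0 mul0n.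
rewrite (cardfsD1 c) cC add1n ltnS => /IH; set C' := C `\ c => {}IH.
pose W := [fset x in X | x + c \in sumset X C'].
have WX : W `<=` X by apply/fsubsetP=> x; rewrite !inE => /andP[].
have C'C d : d \in C' -> d \in C by rewrite !inE => /andP[].
have XC : (#|`sumset X C'| + #|`X| <= #|`sumset X C| + #|`W|)%N.
  rewrite -(fsetIidPr WX) -(cardfsID W X) addnA addnAC leq_add2r.
  rewrite -(card_translate c (X `\` W)) -cardfsUI.
  rewrite [X in (_ + #|`X|)%N](_ : _ = fset0) ?cardfs0 ?addn0.
    apply/fsubset_leq_card/fsubsetP=> z; rewrite inE mem_translate inE.
    case/orP=> [/sumsetP[x [d [xX /C'C dC ->]]]|/andP[_ zX]].
      exact: mem_sumset.
    by rewrite -[z](subrK c); exact: mem_sumset.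
  apply/fsetP=> z; rewrite !inE mem_translate !inE subrK.
  by case: (z \in sumset X C') => //=; rewrite andbT andNb.
have XBC : (#|`sumset X (sumset B C)| + #|`sumset W B| <=
            #|`sumset X (sumset B C')| + #|`sumset X B|)%N.
  have WBX : sumset W B `<=` sumset X B.
    apply/fsubsetP=> _ /sumsetP[x [b [/(fsubsetP WX) xX bB ->]]].
    exact: mem_sumset.
  rewrite -(cardfsID (sumset W B) (sumset X B)) (fsetIidPr WBX).
  rewrite [leqRHS]addnCA addnC leq_add2l.
  rewrite -(card_translate c (sumset X B `\` sumset W B)).
  apply: leq_trans (leq_card_fsetU _ _).
  apply/fsubset_leq_card/fsubsetP=> _
    /sumsetP[x [_ [xX /sumsetP[b [d [bB dC ->]]] ->]]].
  rewrite inE; have [dc|dc] := eqVneq d c; last first.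
    by apply/orP; left; rewrite !mem_sumset // !inE dc.
  have [xbW|xbW] := boolP (x + b \in sumset W B); apply/orP; last first.
    by right; rewrite dc addrA mem_translate addrK inE xbW mem_sumset.
  (* Here [x + b = w + b'] with [w + c = x' + d'] for some [d'] in [C'], so
     [x + b + c = x' + (b' + d')] is already counted in [X + B + C']. *)
  left; case/sumsetP: xbW => w [b' [wW b'B xbE]].
  move: wW; rewrite !inE => /andP[_ /sumsetP[x' [d' [x'X d'C wE]]]].
  apply/sumsetP; exists x', (b' + d'); rewrite mem_sumset //; split=> //.
  by rewrite dc addrA xbE addrAC wE addrAC addrA.
(* Minimality at [W] gives [|X + B| |W| <= |W + B| |X|], so the gain in [XBC], times [|X|], is at
   most [|X + B|] times the gain in [XC]. *)
have := Xmin W WX; nia.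
Qed.

(** Induction on [n]: by [petridis] with [C = nB], each further summand [B] costs at most a factor
    [|X + B| / |X|]. *)
Lemma plunnecke X B n :
  (forall Z, Z `<=` X ->
     (#|`sumset X B| * #|`Z| <= #|`sumset Z B| * #|`X|)%N) ->
  (#|`sumset X (msumset n B)| * #|`X| ^ n <= #|`sumset X B| ^ n * #|`X|)%N.
Proof.
move=> Xmin; elim: n => [|n IH]; first by rewrite /= sumset1 muln1 mul1n.
rewrite !expnS mulnA /=.
apply: leq_trans (leq_mul (petridis X B (msumset n B) Xmin) (leqnn _)) _.
by rewrite -!mulnA leq_mul2l IH orbT.
Qed.

(** Fix one representation [d = y - z] for each [d] in [Y - Z]. The map sending [(x, d)] to
    [(x + y, x + z)] is injective: the difference of the coordinates recovers [d], hence [y], and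
    then [x]. *)
Lemma ruzsa_triangle X Y Z :
  (#|`X| * #|`diffset Y Z| <= #|`sumset X Y| * #|`sumset X Z|)%N.
Proof.
(* The choice of representation is made total by the dummy value [(0, 0)] outside [Y - Z]. *)
have dP (d : V) : {p : V * V |
    d \in diffset Y Z -> [/\ p.1 \in Y, p.2 \in Z & d = p.1 - p.2]}.
  have [dYZ|_] := boolP (d \in diffset Y Z); last by exists (0, 0).
  have ex : exists p : V * V, [&& p.1 \in Y, p.2 \in Z & d == p.1 - p.2].
    case/diffsetP: dYZ => y [z [yY zZ ->]].
    by exists (y, z); rewrite yY zZ eqxx.
  exists (xchoose ex) => _.
  by have /and3P[? ? /eqP] := xchooseP ex.
pose g d := sval (dP d).
have gP d : d \in diffset Y Z ->
  [/\ (g d).1 \in Y, (g d).2 \in Z & d = (g d).1 - (g d).2].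
  exact: (svalP (dP d)).
have -> : (#|`sumset X Y| * #|`sumset X Z|)%N =
          #|`sumset X Y `*` sumset X Z|.
  apply/eqP; rewrite eqn_leq; apply/andP; split.
    apply: (leq_card_mul (f := pair)) => [x y xX yY|x y x' y' _ _ _ _ []//].
    by rewrite in_fsetM xX.
  rewrite -(size_allpairs pair); apply: uniq_leq_size => [|[x y]].
    exact: fset_uniq.
  by rewrite in_fsetM => /andP[xX yY]; apply: allpairs_f.
apply: (leq_card_mul (f := fun x d => (x + (g d).1, x + (g d).2))).
  by move=> x d xX /gP[gY gZ _]; rewrite in_fsetM !mem_sumset.
move=> x d x' d' xX /gP[_ _ dE] xX' /gP[_ _ dE'] [e1 e2].
have dd : d = d'.
  have sh (t a b : V) : a - b = (t + a) - (t + b).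
    by rewrite opprD addrACA subrr add0r.
  by rewrite dE dE' (sh x) e1 e2 -sh.
by split=> //; move: e1; rewrite dd => /addIr.
Qed.

(** Take a nonempty [X] inside [B] minimizing [|X + B| / |X|]. Then [plunnecke] bounds [X + mB] and
    [X + nB], and the triangle inequality through [X] passes to [mB - nB]. *)
Lemma plunnecke_ruzsa B m n : B != fset0 ->
  (#|`diffset (msumset m B) (msumset n B)| * #|`B| ^ (m + n) <=
     #|`sumset B B| ^ (m + n) * #|`B|)%N.
Proof.
move=> B0; pose S := [seq X <- fpowerset B | X != fset0].
have SE X : (X \in S) = (X != fset0) && (X `<=` B).
  by rewrite mem_filter fpowersetE.
pose F X : rat := #|`sumset X B|%:R / #|`X|%:R.
have [|X XS Xmin] := seq_min_exists F S B; first by rewrite SE B0 fsubset_refl.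
move: XS; rewrite SE => /andP[X0 XB].
have Xgt0 : (0 < #|`X|)%N by rewrite cardfs_gt0.
have {}Xmin Z : Z `<=` B ->
    (#|`sumset X B| * #|`Z| <= #|`sumset Z B| * #|`X|)%N.
  move=> ZB; have [->|Z0] := eqVneq Z fset0; first by rewrite cardfs0 muln0.
  have := Xmin Z; rewrite SE Z0 ZB => /(_ isT).
  rewrite ler_pdivrMr ?ltr0n // mulrAC ler_pdivlMr ?ltr0n ?cardfs_gt0 //.
  by rewrite -!natrM ler_nat.
have pl k := plunnecke X B k (fun Z ZX => Xmin Z (fsubset_trans ZX XB)).
(* Comparing [X] with [B] itself: the minimal ratio is at most [|B + B| / |B|]. *)
have := Xmin B (fsubset_refl B).
have := ruzsa_triangle X (msumset m B) (msumset n B).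
have := pl m; have := pl n; have := fsubset_leq_card XB.
move: Xgt0; rewrite !expnD.
set x := #|`X|; set b := #|`B|; set p := #|`sumset X B|; set q := #|`sumset B B|.
set D := #|`diffset _ _|; set u := #|`sumset X (msumset m B)|.
set v := #|`sumset X (msumset n B)|.
move=> x0 xb hv hu hD hp.
have hDp : (D * x ^ (m + n) <= p ^ (m + n) * x)%N.
  rewrite -(leq_pmul2l x0) mulnA; apply: leq_trans (leq_mul hD (leqnn _)) _.
  rewrite !expnD mulnACA; apply: leq_trans (leq_mul hu hv) _.
  by rewrite mulnACA mulnCA.
have {}hp : (p ^ (m + n) * b ^ (m + n) <= q ^ (m + n) * x ^ (m + n))%N.
  by rewrite -!expnMn; case: (m + n)%N => // k; rewrite leq_exp2r.
rewrite -!expnD.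
have xk : (0 < x ^ (m + n))%N by rewrite expn_gt0 x0.
(* With [k = m + n]: [D b^k x^k <= p^k x b^k <= q^k x^k x <= q^k x^k b], the last step by
   [x <= b]. *)
rewrite -(leq_pmul2r xk) mulnAC; apply: leq_trans (leq_mul hDp (leqnn _)) _.
rewrite mulnAC; apply: leq_trans (leq_mul hp (leqnn _)) _.
by rewrite mulnAC leq_mul2r leq_mul2l xb !orbT.
Qed.

End Sumsets.

(** * Squares of differences *)

Section Distances.
Variable R : realType.
Implicit Type A : {fset R}.

Definition square_set A : {fset R} := [fset d ^+ 2 | d in difference_set A].

Lemma difference_setP A z :
  reflect (exists x y, [/\ x \in A, y \in A & z = x - y])
          (z \in difference_set A).
Proof. exact: (diffsetP R A A z). Qed.

Lemma square_setP A z :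
  reflect (exists x y, [/\ x \in A, y \in A & z = (x - y) ^+ 2])
          (z \in square_set A).
Proof.
apply: (iffP (imfsetP _ _ _ _)) => /=.
  by move=> [_ /difference_setP[x [y [xA yA ->]]] ->]; exists x, y.
move=> [x [y [xA yA ->]]]; exists (x - y) => //.
by apply/difference_setP; exists x, y.
Qed.

Lemma mem_square_set {A x y} :
  x \in A -> y \in A -> (x - y) ^+ 2 \in square_set A.
Proof. by move=> xA yA; apply/square_setP; exists x, y. Qed.

Lemma distance_set_sumset A :
  distance_set (A `*` A) = sumset (square_set A) (square_set A).
Proof.
apply/fsetP=> z; apply/imfset2P/sumsetP => /=.
  move=> [[x x'] /=]; rewrite in_fsetM /= => /andP[xA x'A].
  move=> [[y y'] /=]; rewrite in_fsetM /= => /andP[yA y'A] ->.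
  by exists ((x - y) ^+ 2), ((x' - y') ^+ 2); rewrite !mem_square_set.
move=> [_ [_ [/square_setP[x [y [xA yA ->]]]
  /square_setP[x' [y' [x'A y'A ->]]] ->]]].
exists (x, x'); first by rewrite in_fsetM xA.
by exists (y, y'); first by rewrite in_fsetM yA.
Qed.

Lemma mem_diffset_products A d1 e1 d2 e2 :
  d1 \in difference_set A -> e1 \in difference_set A ->
  d2 \in difference_set A -> e2 \in difference_set A ->
  2 * (d1 * e1 + d2 * e2) \in
    diffset (msumset 4 (square_set A)) (msumset 4 (square_set A)).
Proof.
move=> /difference_setP[a [d [aA dA ->]]] /difference_setP[c [b [cA bA ->]]].
move=> /difference_setP[a' [d' [a'A d'A ->]]] /difference_setP[c' [b' [c'A b'A ->]]].
have mem1 x y : x \in A -> y \in A -> (x - y) ^+ 2 \in msumset 1 (square_set A).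
  by move=> xA yA; exact/mem_msumset1/mem_square_set.
apply/diffsetP.
(* The polarization identity is applied to each of the two products; the four squares with a plus
   sign come first, the four with a minus sign second. *)
exists ((a - b) ^+ 2 + ((d - c) ^+ 2 + ((a' - b') ^+ 2 + (d' - c') ^+ 2))).
exists ((a - c) ^+ 2 + ((d - b) ^+ 2 + ((a' - c') ^+ 2 + (d' - b') ^+ 2))).
split; last by ring.
- by do 3![apply: (@mem_msumsetD _ _ 1); first exact: mem1]; exact: mem1.
- by do 3![apply: (@mem_msumsetD _ _ 1); first exact: mem1]; exact: mem1.
Qed.

Lemma difference_set_pos_exists A : (1 < #|`A|)%N ->
  exists2 d, d \in difference_set A & 0 < d.
Proof.
move=> A1; have /fset0Pn[a aA] : A != fset0.
  by rewrite -cardfs_gt0 (ltn_trans _ A1).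
have /fset0Pn[b] : A `\ a != fset0.
  by rewrite -cardfs_gt0; move: A1; rewrite (cardfsD1 a) aA.
rewrite !inE => /andP[ba bA]; case: (ltgtP b a) ba => // lt_ab _.
  by exists (a - b); [apply/difference_setP; exists a, b | rewrite subr_gt0].
by exists (b - a); [apply/difference_setP; exists b, a | rewrite subr_gt0].
Qed.

Lemma leq_card_diffset_products A : (1 < #|`A|)%N ->
  (#|`[fset d in difference_set A | (0 < d)%R]| * #|`A| <=
     #|`diffset (msumset 4 (square_set A)) (msumset 4 (square_set A))|)%N.
Proof.
set P := [fset d in _ | _] => A1.
have PP d : (d \in P) = (d \in difference_set A) && (0 < d) by rewrite !inE.
have memD x y : x \in A -> y \in A -> x - y \in difference_set A.
  by move=> xA yA; apply/difference_setP; exists x, y.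
have /fset0Pn[a0 a0A] : A != fset0 by rewrite -cardfs_gt0 (ltn_trans _ A1).
have [p0 p0D p0_gt0] := difference_set_pos_exists A A1.
have p0P : p0 \in P by rewrite PP p0D.
have [m mP mmin] := seq_min_exists (fun x : R => x) P p0 p0P.
have [M MP Mmax] := seq_min_exists (fun x : R => - x) P p0 p0P.
move: mP MP; rewrite !PP => /andP[mD m0] /andP[MD M0].
apply: (leq_card_mul (f := fun d a => 2 * (m * d + M * (a - a0)))).
  by move=> d a; rewrite PP => /andP[dD _] aA; apply: mem_diffset_products; rewrite ?memD.
(* If [a < a'], equality would give [m M <= M (a' - a) = m (d - d') < m M], the strict step because
   [d <= M] and [0 < d']. Exchanging the two pairs excludes [a' < a]. *)
have sep d a d' a' : d \in P -> a \in A -> d' \in P -> a' \in A ->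
    m * d + M * (a - a0) = m * d' + M * (a' - a0) -> ~~ (a < a').
  rewrite PP => dP aA; rewrite PP => /andP[_ d'0] a'A eq_md; apply/negP => lt_a.
  have ma : m <= a' - a by apply: mmin; rewrite PP memD // subr_gt0.
  have dM : d <= M by rewrite -lerN2; apply: Mmax; rewrite PP.
  by nra.
move=> d a d' a' dP aA d'P a'A eq_md.
have {}eq_md : m * d + M * (a - a0) = m * d' + M * (a' - a0) by lra.
have aa' : a = a'.
  apply/eqP; rewrite eq_le !leNgt (sep _ _ _ _ dP aA d'P a'A eq_md).
  by rewrite (sep _ _ _ _ d'P a'A dP aA (esym eq_md)).
split=> //; apply: (mulfI (lt0r_neq0 m0)).
by move: eq_md; rewrite aa' => /addIr.
Qed.

(** With [P] the positive differences, [|P| |A| <= |4B - 4B| <= |B + B|^8 / |B|^7]; since [|A - A|],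
    [|B|] and [|P|] agree up to constants when [|A| > 1], this bounds [|A - A|^8 |A|]. *)
Lemma card_difference_set_distance_set A : A != fset0 ->
  (#|`difference_set A| ^ 8 * #|`A| <=
     4 ^ 8 * #|`distance_set (A `*` A)| ^ 8)%N.
Proof.
move=> A0; rewrite distance_set_sumset.
have [a0 a0A] := fset0Pn _ A0.
have B0 : 0 \in square_set A.
  by apply/square_setP; exists a0, a0; rewrite subrr expr0n.
have Bgt0 : (0 < #|`square_set A|)%N by rewrite cardfs_gt0; apply/fset0Pn; exists 0.
have BB := leq_card_sumset _ _ _ _ B0 : (#|`square_set A| <= _)%N.
pose P := [fset d in difference_set A | 0 < d].
have PP d : (d \in P) = (d \in difference_set A) && (0 < d) by rewrite !inE.
have DN d : d \in difference_set A -> - d \in difference_set A.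
  case/difference_setP=> x [y [xA yA ->]]; apply/difference_setP.
  by exists y, x; rewrite opprB.
have N0 : 0 \notin P by rewrite PP ltxx andbF.
have BN : (#|`square_set A| <= #|`P|.+1)%N.
  (* The [1] is rewritten as the truth value of [0 \notin P], so that the right side becomes the
     cardinality of [P] with [0] adjoined. Every square of a difference is the square of an element
     of that set, by symmetry of [A - A]. *)
  rewrite -add1n -[1%N]/(true : nat) -N0 -cardfsU1.
  apply: (leq_card_image (fun d => d ^+ 2)) => z /imfsetP[d /= dD ->].
  case: (ltgtP d 0) => [d0|d0|->].
  - by exists (- d); rewrite ?sqrrN // !inE DN //= oppr_gt0 d0 orbT.
  - by exists d; rewrite // !inE dD d0 orbT.
  - by exists 0; rewrite // !inE eqxx.
(* Each difference is plus or minus the square root of its square. *)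
have DB : (#|`difference_set A| <= 2 * #|`square_set A|)%N.
  rewrite mul2n -addnn.
  pose Sq := [fset Num.sqrt b | b in square_set A].
  pose Sn := [fset - Num.sqrt b | b in square_set A].
  apply: (@leq_trans #|`Sq `|` Sn|); last first.
    by apply: leq_trans (leq_card_fsetU _ _) _; apply: leq_add; exact: leq_imfset_card.
  apply/fsubset_leq_card/fsubsetP => d dD; rewrite inE.
  have dB : d ^+ 2 \in square_set A by exact: in_imfset.
  have [d0|/ltW d0] := leP 0 d; apply/orP; [left|right]; apply/imfsetP.
    by exists (d ^+ 2); rewrite // sqrtr_sqr ger0_norm.
  by exists (d ^+ 2); rewrite // sqrtr_sqr ler0_norm // opprK.
(* A singleton has no positive difference, so it is treated apart. *)
have [A1|A1] := leqP #|`A| 1.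
  have D1 : (#|`difference_set A| <= 1)%N.
    have /eqP/cardfs1P[a AE] : #|`A| = 1%N.
      by apply/eqP; rewrite eqn_leq A1 cardfs_gt0.
    rewrite -(cardfs1 (0 : R)); apply/fsubset_leq_card/fsubsetP => d.
    case/difference_setP=> x [y []]; rewrite AE !inE => /eqP-> /eqP-> ->.
    by rewrite subrr.
  apply: (@leq_trans 1); first by rewrite -(exp1n 8) -[leqRHS]muln1 leq_mul ?leq_exp2r.
  by rewrite muln_gt0 !expn_gt0 (leq_trans Bgt0 BB).
have := leq_card_diffset_products A A1.
have := plunnecke_ruzsa _ (square_set A) 4 4; rewrite -cardfs_gt0 => /(_ Bgt0).
rewrite -/P.
have [p pD p_gt0] := difference_set_pos_exists A A1.
have : (0 < #|`P|)%N by rewrite cardfs_gt0; apply/fset0Pn; exists p; rewrite PP pD.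
move: DB BN Bgt0.
set D := #|`diffset _ _|; set b := #|`square_set A|; set q := #|`sumset _ _|.
set d := #|`difference_set A|; set r := #|`P|; set n := #|`A|.
move=> db br b0 r0 pr rn.
have bn : (b ^ 8 * n <= 2 * q ^ 8)%N.
  rewrite -(leq_pmul2r b0); apply: (@leq_trans (2 * (D * b ^ 8))%N).
    (* As [P] is nonempty, [b <= r + 1 <= 2 r]. *)
    have nb : (n * b <= 2 * D)%N by nia.
    by rewrite [leqRHS]mulnA [leqRHS]mulnC -mulnA leq_mul2l nb orbT.
  by rewrite -mulnA leq_mul2l.
apply: (@leq_trans ((2 * b) ^ 8 * n)%N); first by rewrite leq_mul2r leq_exp2r ?db ?orbT.
(* The constant is [2^8 * 2 <= 4^8]. *)
by rewrite expnMn; nia.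
Qed.

End Distances.

Theorem mainTheorem1 (R : realType) :
  exists C : R, 0 < C /\
    forall A : {fset R}, A != fset0 ->
      (#|` difference_set A|)%:R <=
        C * (#|` distance_set (A `*` A)|)%:R * (#|` A|)%:R `^ (- (1 / 8)).
Proof.
(* The constant [4] is the eighth root of the factor [4 ^ 8] in [card_difference_set_distance_set];
   the power of [|A|] is moved to the left and both sides are raised to the eighth power. *)
exists 4; split=> // A A0.
have n0 : (0 : R) < #|`A|%:R by rewrite ltr0n cardfs_gt0.
rewrite powRN ler_pdivlMr ?powR_gt0 //.
rewrite -(ler_pXn2r (_ : 0 < 8)%N) ?nnegrE ?mulr_ge0 ?powR_ge0 ?ler0n //.
rewrite !exprMn -[(_ `^ _) ^+ 8]powR_mulrn ?powR_ge0 // -powRrM.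
rewrite (_ : 1 / 8 * 8%:R = 1); last by field.
rewrite powRr1 ?(ltW n0) // -!natrX -!natrM ler_nat.
exact: card_difference_set_distance_set.
Qed.
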